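(* Let $U:[0,\infty)\to\mathbb{R}$ be a continuous, strictly increasing disutility function of a risk-averse Insured (that is, $U$ is strictly convex). Then the following are equivalent. (i) For all independent non-negative random losses $\tilde X_1,\tilde X_2$ with probability densities $D_{\tilde X_1},D_{\tilde X_2}$ on $[0,\infty)$ such that the expected disutilities of $\tilde X_1$, $\tilde X_2$ and $\tilde X_1+\tilde X_2$ are finite, the fair premia $P_1$, $P_2$, $P$ of the policies fully covering $\tilde X_1$, $\tilde X_2$ and $\tilde X=\tilde X_1+\tilde X_2$ respectively satisfy $P=P_1+P_2$; that is, $$CE(\tilde X_1+\tilde X_2)=CE(\tilde X_1)+CE(\tilde X_2).$$ (ii) Up to a positive affine transformation, $U$ belongs to the one-parameter exponential family: there exist $\rho>0$, $a\in\mathbb{R}$ and $b>0$ such that $$U(l)=a+b\,\rho\left(e^{l/\rho}-1\right)\qquad\text{for all } l\ge 0 .$$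
   Context: Losses and costs are taken with positive sign, so an Insured is described by a strictly increasing disutility function $U$ (rather than a utility function). For a non-negative random loss $\tilde\Phi$ with density $D_{\tilde\Phi}$ on $[0,\infty)$ and finite expected disutility, the certain equivalent is $$CE(\tilde\Phi):=U^{-1}\!\left(\int_0^{+\infty}D_{\tilde\Phi}(l)\,U(l)\,dl\right).$$ For a policy with premium $P$ and total retained amount $\tilde R$ on a risk with total loss $\tilde X$, the premium $P$ is called fair if $CE(\tilde X)=CE(\tilde R+P)$. For a policy giving full coverage (retention identically zero) the fair premium is therefore $P=CE(\tilde X)$. Disutility functions differing by a positive affine transformation $U\mapsto a+bU$ ($b>0$) have the same certain equivalents and are regarded as equivalent. *)

(* Defs.v *)
From HB Require Import structures.
From mathcomp Require Import all_boot all_order all_algebra.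
From mathcomp Require Import all_classical all_reals all_analysis measurable_realfun.

Set Implicit Arguments.
Unset Strict Implicit.
Unset Printing Implicit Defensive.
Import Order.TTheory GRing.Theory Num.Theory.
Import numFieldNormedType.Exports.

Local Open Scope classical_set_scope.
Local Open Scope ring_scope.

Definition strictly_increasing_on (R : realType) (A : set R) (U : R -> R) : Prop :=
  forall x y, A x -> A y -> x < y -> U x < U y.

(** [A] is meant to be an interval. The library's [convex_function] is the
    non-strict notion. *)
Definition strictly_convex_on (R : realType) (A : set R) (U : R -> R) : Prop :=
  forall x y t, A x -> A y -> x != y -> 0 < t < 1 ->
    U (t * x + (1 - t) * y) < t * U x + (1 - t) * U y.

(** [D] is a Lebesgue density of [X] on [0, +oo[; only the values of [D] on
    [0, +oo[ matter. Taking [B := setT] gives total mass 1. *)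
Record has_density (d : measure_display) (Omega : measurableType d)
    (R : realType) (P : probability Omega R) (X : {RV P >-> R})
    (D : R -> R) : Prop := HasDensity {
  density_measurable : measurable_fun (`[0, +oo[ : set R) D ;
  density_ge0 : forall l, 0 <= l -> 0 <= D l ;
  density_distribution : forall B : set R, measurable B ->
    distribution P X B =
      (\int[lebesgue_measure]_(l in B `&` `[0%R, +oo[) (D l)%:E)%E
}.

Definition independent_RVs (d : measure_display) (Omega : measurableType d)
    (R : realType) (P : probability Omega R) (X Y : {RV P >-> R}) : Prop :=
  forall A B : set R, measurable A -> measurable B ->
    P (X @^-1` A `&` Y @^-1` B) = (P (X @^-1` A) * P (Y @^-1` B))%E.

Definition finite_expected_disutility (R : realType) (U D : R -> R) : Prop :=
  lebesgue_measure.-integrable (`[0, +oo[ : set R) (fun l => (D l * U l)%:E).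

Definition expected_disutility (R : realType) (U D : R -> R) : R :=
  \int[lebesgue_measure]_(l in `[0, +oo[) (D l * U l).

(** The certain equivalent of a loss with density [D]. Here [U^-1] is the
    inverse of [U] restricted to [0, +oo[; the default value 0 is taken only
    outside the range of [U] on [0, +oo[, which no finite expected disutility
    reaches when [U] is continuous, strictly increasing and strictly convex. *)
Definition CE (R : realType) (U D : R -> R) : R :=
  'pinv_(fun=> 0) `[0, +oo[ U (expected_disutility U D).

(* Main.v *)
Require Import Defs.
From HB Require Import structures.
From mathcomp Require Import all_boot all_order all_algebra.
From mathcomp Require Import all_classical all_reals all_analysis measurable_realfun.
From mathcomp Require Import ring lra.

Set Implicit Arguments.
Unset Strict Implicit.
Unset Printing Implicit Defensive.
Import Order.TTheory GRing.Theory Num.Theory.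
Import numFieldNormedType.Exports.

Local Open Scope classical_set_scope.
Local Open Scope ring_scope.

(** For the exponential disutility [CE] is [rho * ln E[exp(X/rho)]], and
    independence makes the expectation of the product factor.

    Conversely, for [0 < z < y] write [U z = p U 0 + q U y] with [p + q = 1].
    Apply additivity to a loss equal to [0] with probability [p] and to [y] with
    probability [q], smeared uniformly over a window of width [e] so that it has
    a density, and to an independent loss uniform on [[c, c + e]]. Monotonicity
    of [U] squeezes the three certain equivalents, and [e -> 0] gives
    [U (z + c) = p U c + q U (y + c)]. Thus, for [u = U - U 0], [u (z + c) - u c]
    is proportional to [u z]; by symmetry in [z] and [c] the factor is
    [1 + k u c], so [1 + k u] is multiplicative and monotone, hence exponential,
    and strict convexity forces [k > 0]. *)

(** * Densities and independence *)

Section integral_against_a_density.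
Local Open Scope ereal_scope.
Context d (T : measurableType d) (R : realType).
Variables (m nu : {measure set T -> \bar R}) (g : T -> R).
Hypotheses (mg : measurable_fun setT g) (g0 : forall x, (0 <= g x)%R).
Hypothesis nuE : forall B, measurable B -> nu B = \int[m]_(x in B) (g x)%:E.

Import HBNNSimple.

Let mgE : measurable_fun setT (EFin \o g).
Proof. exact/measurable_EFinP. Qed.

Let ge0_integral_density_nnsfun (f : {nnsfun T >-> R}) :
  \int[nu]_x (f x)%:E = \int[m]_x ((f x)%:E * (g x)%:E).
Proof.
under [LHS]eq_integral do rewrite fimfunE -fsumEFin//.
rewrite [LHS]ge0_integral_fsum//; last 2 first.
  - by move=> r; exact/measurable_EFinP/measurableT_comp.
  - by move=> n x _; rewrite EFinM nnfun_muleindic_ge0.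
under [RHS]eq_integral.
  move=> x xD; rewrite fimfunE -fsumEFin// muleC ge0_mule_fsumr; last first.
    by move=> r; rewrite EFinM nnfun_muleindic_ge0.
  over.
rewrite [RHS]ge0_integral_fsum//; last 2 first.
  - move=> r; apply: emeasurable_funM => //; apply/measurable_EFinP.
    exact: measurableT_comp.
  - by move=> n x _; rewrite EFinM mule_ge0 ?lee_fin// -lee_fin EFinM nnfun_muleindic_ge0.
apply: eq_fsbigr => r rf.
have r0 : (0 <= r)%R by move: rf; rewrite inE => -[x _ <-].
have mr : measurable (f @^-1` [set r]) by [].
under eq_integral do rewrite EFinM.
rewrite ge0_integralZl//; last exact/measurable_EFinP.
rewrite integral_indic// setIT nuE//.
under [RHS]eq_integral do rewrite EFinM muleCA.
rewrite ge0_integralZl//; last 2 first.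
  - by apply: emeasurable_funM => //; apply/measurable_EFinP.
  - by move=> x _; rewrite mule_ge0// lee_fin.
congr (_ * _); rewrite integral_mkcond; apply: eq_integral => x _.
by rewrite patchE indicE; case: ifPn; rewrite ?mule1 ?mule0.
Qed.

(** The density is given only as an identity between set functions. Linearity carries it to simple
    functions, and monotone convergence along [f_] to every nonnegative measurable integrand. *)
Lemma ge0_integral_density (f : T -> \bar R) :
    measurable_fun setT f -> (forall x, 0 <= f x) ->
  \int[nu]_x f x = \int[m]_x (f x * (g x)%:E).
Proof.
move=> mf f0.
pose f_ := nnsfun_approx measurableT mf.
have f_cvg x : (f_ n x)%:E @[n --> \oo] --> f x by exact: cvg_nnsfun_approx.
transitivity (lim (\int[nu]_x (f_ n x)%:E @[n --> \oo])).
  rewrite -monotone_convergence//=.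
  - by apply: eq_integral => x _; exact/esym/cvg_lim.
  - by move=> n; exact/measurable_EFinP/measurable_funTS.
  - by move=> n ? _; rewrite lee_fin.
  - by move=> ? _ ? ? mn; rewrite lee_fin; exact/lefP/nd_nnsfun_approx.
under eq_fun do rewrite ge0_integral_density_nnsfun.
rewrite -monotone_convergence//=.
- apply: eq_integral => x _; apply/cvg_lim => //.
  under eq_fun do rewrite muleC.
  rewrite (muleC (f x)).
  by apply: cvgeZl => //; exact: f_cvg.
- move=> n; apply: emeasurable_funM => //.
  exact/measurable_EFinP/measurable_funTS.
- by move=> n x _; rewrite mule_ge0// lee_fin.
- move=> x _ a b ab; rewrite lee_wpmul2r ?lee_fin//.
  exact/lefP/nd_nnsfun_approx.
Qed.

End integral_against_a_density.

Section independence.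
Local Open Scope ereal_scope.
Context d (T : measurableType d) (R : realType) (P : probability T R).

(** Independence says that the joint law and the product of the laws agree on rectangles, hence
    everywhere; Tonelli then factors the integral. *)
Lemma ge0_expectation_indep_mul (X Y : {RV P >-> R}) (f g : R -> \bar R) :
    independent_RVs X Y ->
    measurable_fun setT f -> measurable_fun setT g ->
    (forall x, 0 <= f x) -> (forall x, 0 <= g x) ->
  \int[P]_w (f (X w) * g (Y w)) = \int[P]_w f (X w) * \int[P]_w g (Y w).
Proof.
move=> indXY mf mg f0 g0.
have mXY : measurable_fun setT (fun w => (X w, Y w)).
  exact: measurable_fun_pair.
pose Z : {mfun T >-> (R * R)%type} := mfun_Sub (mem_set mXY).
have mfg : measurable_fun setT (fun z : (R * R)%type => f z.1 * g z.2).
  by apply: emeasurable_funM; apply: measurableT_comp.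
have fg0 (z : (R * R)%type) : 0 <= f z.1 * g z.2 by rewrite mule_ge0.
transitivity (\int[distribution P Z]_z (f z.1 * g z.2)).
  by rewrite ge0_integral_distribution.
transitivity (\int[distribution P X \x distribution P Y]_z (f z.1 * g z.2)).
  apply: eq_measure_integral => A mA _; apply/esym.
  by apply: product_measure_unique => // B C mB mC; exact: indXY.
rewrite fubini_tonelli1// /fubini_F/=.
under eq_integral do rewrite ge0_integralZl//.
rewrite ge0_integralZr ?integral_ge0//.
by rewrite !ge0_integral_distribution.
Qed.

End independence.

Section expectation_of_a_loss.
Context d (T : measurableType d) (R : realType) (P : probability T R).
Variables (X : {RV P >-> R}) (D : R -> R).
Hypothesis XD : has_density X D.

Lemma ge0_expectation_density (f : R -> R) :
    measurable_fun setT f -> (forall x, 0 <= f x) ->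
  (\int[P]_w (f (X w))%:E =
   \int[lebesgue_measure]_(l in `[0%R, +oo[) (D l * f l)%:E)%E.
Proof.
move=> mf f0.
have [mD D0 XDE] := XD.
(* Only the values of [D] on the half-line are controlled, so [D] is cut off to 0 elsewhere before
   it serves as a density on the whole line. *)
have mD' : measurable_fun setT (D \_ (`[0%R, +oo[ : set R)).
  apply: (iffLR (measurable_restrictT _ _)) => //; exact: measurable_itv.
have D0' x : 0 <= (D \_ (`[0%R, +oo[ : set R)) x.
  by rewrite patchE; case: ifPn => //; rewrite inE/= in_itv/= andbT; exact: D0.
(* [lebesgue_measure] lives on [measurableTypeR R], which differs from [R] by its display. *)
have mX : @measurable_fun _ _ T (measurableTypeR R) setT X.
  have mX : measurable_fun setT X by [].
  exact: mX.
pose X' : {mfun T >-> measurableTypeR R} :=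
  @mfun_Sub _ _ T (measurableTypeR R) X (mem_set mX).
have mfE : measurable_fun setT (EFin \o f : measurableTypeR R -> _).
  exact/measurable_EFinP.
transitivity (\int[distribution P X']_x (f x)%:E)%E.
  by rewrite ge0_integral_distribution.
rewrite (@ge0_integral_density _ _ _ (@lebesgue_measure R)
  (distribution P X') _ mD' D0')//.
  rewrite [RHS]integral_mkcond; apply: eq_integral => x _.
  by rewrite !patchE; case: ifPn => _; rewrite ?mule0// -EFinM mulrC.
move=> B mB; rewrite [LHS]XDE// setIC integral_mkcondl.
by apply: eq_integral => x _; rewrite !patchE; case: ifPn.
Qed.

Variables (U f : R -> R) (k : R).
Hypotheses (mf : measurable_fun setT f) (f0 : forall x, 0 <= f x).
Hypothesis UE : forall l, 0 <= l -> U l = k + f l.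

Let mu := @lebesgue_measure R.

Let integral_D : (\int[mu]_(l in `[0%R, +oo[) (D l)%:E = 1)%E.
Proof.
by have [_ _ /(_ _ measurableT)] := XD; rewrite setTI probability_setT => <-.
Qed.

Let integrable_D : mu.-integrable (`[0, +oo[ : set R) (EFin \o D).
Proof.
have [mD D0 _] := XD.
apply/integrableP; split; first exact/measurable_EFinP.
under eq_integral.
  move=> x; rewrite inE/= in_itv/= andbT => x0; rewrite ger0_norm ?D0//.
  over.
by rewrite /= integral_D ltry.
Qed.

Let measurable_Df : measurable_fun (`[0, +oo[ : set R) (fun l => D l * f l).
Proof.
by have [mD _ _] := XD; apply: measurable_funM => //; exact: measurable_funTS.
Qed.

Let integrable_DfP :
  mu.-integrable (`[0, +oo[ : set R) (fun l => (D l * f l)%:E) <->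
  (\int[P]_w (f (X w))%:E < +oo)%E.
Proof.
have [mD D0 _] := XD.
rewrite ge0_expectation_density//.
have -> : (\int[mu]_(l in `[0%R, +oo[) (D l * f l)%:E =
    \int[mu]_(l in `[0%R, +oo[) `|(D l * f l)%:E|)%E.
  apply: eq_integral => x; rewrite inE/= in_itv/= andbT => x0.
  by rewrite ger0_norm// mulr_ge0// D0.
split; first by case/integrableP.
by move=> ?; apply/integrableP; split => //; exact/measurable_EFinP.
Qed.

(** [U] may be negative. Splitting off the constant [k] leaves a nonnegative [f], and the difference
    [k * D] of the two integrands is integrable because [D] has mass 1. *)
Lemma finite_expected_disutility_shift :
  finite_expected_disutility U D <-> (\int[P]_w (f (X w))%:E < +oo)%E.
Proof.
rewrite -integrable_DfP.
have Dk : mu.-integrable (`[0, +oo[ : set R) (fun l => (k * D l)%:E).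
  exact: (integrableZl _ _ integrable_D).
split => DU.
- apply: (eq_integrable _ (fun l : measurableTypeR R => (D l * U l)%:E - (k * D l)%:E)%E) => //.
    move=> x; rewrite inE/= in_itv/= andbT => x0.
    by rewrite -EFinB UE//; congr (_ %:E); ring.
  exact: integrableB.
- apply: (eq_integrable _ (fun l : measurableTypeR R => (D l * f l)%:E + (k * D l)%:E)%E) => //.
    move=> x; rewrite inE/= in_itv/= andbT => x0.
    by rewrite -EFinD UE//; congr (_ %:E); ring.
  exact: integrableD.
Qed.

Lemma expected_disutility_shift : finite_expected_disutility U D ->
  (expected_disutility U D)%:E = (k%:E + \int[P]_w (f (X w))%:E)%E.
Proof.
move=> DU; rewrite /expected_disutility /Rintegral fineK; last first.
  exact: integrable_fin_num DU.
have /integrable_DfP Df := (iffLR finite_expected_disutility_shift) DU.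
rewrite ge0_expectation_density// (eq_integral (fun l : measurableTypeR R =>
    k%:E * (D l)%:E + (D l * f l)%:E)%E); last first.
  move=> x; rewrite inE/= in_itv/= andbT => x0.
  by rewrite -EFinM -EFinD UE//; congr (_ %:E); ring.
rewrite integralD//=; last exact: integrableZl.
by rewrite integralZl// integral_D mule1.
Qed.

End expectation_of_a_loss.

(** * Exponential disutilities *)

(** Strict monotonicity makes [U] injective on the half-line, so the partial inverse recovers [s].
    This reduces computing [CE] to exhibiting a preimage. *)
Lemma CE_eq (R : realType) (U D : R -> R) (s : R) :
    strictly_increasing_on `[0, +oo[ U -> 0 <= s ->
  U s = expected_disutility U D -> CE U D = s.
Proof.
move=> Uincr s0 Us; rewrite /CE -Us pinvKV//; last first.
  by rewrite inE/= in_itv/= andbT.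
move=> x y; rewrite !inE => xA yA; apply: contra_eq => xy.
by move: xy; rewrite neq_lt => /orP[] xy; [rewrite lt_eqF|rewrite gt_eqF];
  rewrite // Uincr.
Qed.

Section exponential_disutility.
Context (R : realType) (U : R -> R) (rho a b : R).
Hypotheses (rho0 : 0 < rho) (b0 : 0 < b).
Hypothesis Uincr : strictly_increasing_on `[0, +oo[ U.
Hypothesis UE : forall l, 0 <= l -> U l = a + b * (rho * (expR (l / rho) - 1)).

Let measurable_expR_div : measurable_fun setT (fun x : R => expR (x / rho)).
Proof. by apply: measurableT_comp => //; exact: measurable_funM. Qed.

(** The moment generating function of [X] at [1 / rho], with values in the extended reals since it
    may be infinite. *)
Let mgf d (T : measurableType d) (P : probability T R) (X : {RV P >-> R}) :=
  (\int[P]_w (expR (X w / rho))%:E)%E.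

(** The expected disutility is an affine function of [mgf X], and solving
    [U s = a - b * rho + b * rho * mgf X] for [s] gives the logarithm. *)
Lemma CE_exponential d (T : measurableType d) (P : probability T R)
    (X : {RV P >-> R}) (D : R -> R) :
    {ae P, forall w, 0 <= X w} -> has_density X D ->
    finite_expected_disutility U D ->
  [/\ mgf X \is a fin_num, 1 <= fine (mgf X) &
      CE U D = rho * ln (fine (mgf X))].
Proof.
move=> X0 XD finD.
have brho0 : 0 < b * rho by rewrite mulr_gt0.
pose f x := b * rho * expR (x / rho).
have mf : measurable_fun setT f by exact: measurable_funM.
have f0 x : 0 <= f x by rewrite mulr_ge0 ?expR_ge0// ltW.
have UfE l : 0 <= l -> U l = (a - b * rho) + f l.
  by move=> l0; rewrite UE// /f; ring.
have mX : measurable_fun setT (fun w => (expR (X w / rho))%:E).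
  apply/measurable_EFinP.
  exact: (measurableT_comp measurable_expR_div).
have fXE : (\int[P]_w (f (X w))%:E = (b * rho)%:E * mgf X)%E.
  by rewrite /mgf -ge0_integralZl//= lee_fin ltW.
(* This lower bound makes the logarithm nonnegative, so that the candidate lies in the half-line
   where [U] is inverted. *)
have mgf_ge1 : (1 <= mgf X)%E.
  rewrite -(probability_setT P) -[leLHS]mul1e -integral_cst//.
  apply: ae_ge0_le_integral => //=.
  by apply: filterS X0 => w Xw _; rewrite lee_fin -expR0 ler_expR divr_ge0// ltW.
have mgf_lty : (mgf X < +oo)%E.
  move: finD; rewrite (finite_expected_disutility_shift XD mf f0 UfE) fXE.
  by case: (mgf X) mgf_ge1 => [r _ _||//]; rewrite ?ltry// gt0_muley ?lte_fin.
have mgf_fin : mgf X \is a fin_num.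
  by rewrite ge0_fin_numE// (le_trans _ mgf_ge1).
have m1 : 1 <= fine (mgf X) by rewrite -lee_fin fineK.
split => //; apply: CE_eq => //.
  by rewrite mulr_ge0 ?ln_ge0// ltW.
apply: EFin_inj; rewrite (expected_disutility_shift XD mf f0 UfE finD) fXE.
rewrite -(fineK mgf_fin) -EFinM -EFinD; congr EFin.
rewrite UE; last by rewrite mulr_ge0 ?ln_ge0// ltW.
rewrite mulrAC mulfV ?gt_eqF// mul1r lnK; last by rewrite posrE (lt_le_trans _ m1).
by rewrite fineK//; ring.
Qed.

(** Independence makes [mgf] multiplicative, and the logarithm turns the product into a sum. *)
Lemma CE_exponential_add d (T : measurableType d) (P : probability T R)
    (X1 X2 : {RV P >-> R}) (D1 D2 D : R -> R) :
    {ae P, forall w, 0 <= X1 w} -> {ae P, forall w, 0 <= X2 w} ->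
    independent_RVs X1 X2 ->
    has_density X1 D1 -> has_density X2 D2 ->
    has_density (X1 \+ X2 : {RV P >-> R}) D ->
    finite_expected_disutility U D1 ->
    finite_expected_disutility U D2 ->
    finite_expected_disutility U D ->
  CE U D = CE U D1 + CE U D2.
Proof.
move=> X1ge0 X2ge0 indX XD1 XD2 XD fin1 fin2 fin.
have Xge0 : {ae P, forall w, 0 <= (X1 \+ X2) w}.
  by apply: filterS2 X1ge0 X2ge0 => w /= ? ?; rewrite addr_ge0.
have [E1 m1 ->] := CE_exponential X1ge0 XD1 fin1.
have [E2 m2 ->] := CE_exponential X2ge0 XD2 fin2.
have [_ _ ->] := CE_exponential Xge0 XD fin.
have -> : mgf (X1 \+ X2 : {RV P >-> R}) = (mgf X1 * mgf X2)%E.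
  rewrite /mgf.
  rewrite -(@ge0_expectation_indep_mul _ _ _ P X1 X2 (fun x => (expR (x / rho))%:E)
    (fun x => (expR (x / rho))%:E))//.
  - by apply: eq_integral => w _; rewrite -EFinM -expRD mulrDl.
  - exact/measurable_EFinP.
  - exact/measurable_EFinP.
by rewrite fineM// lnM ?posrE ?(lt_le_trans ltr01)// mulrDr.
Qed.

End exponential_disutility.

(** * The translation equation *)

Lemma additive_nondecreasing_linear (R : realType) (g : R -> R) :
    (forall x y, 0 <= x -> 0 <= y -> g (x + y) = g x + g y) ->
    (forall x y, 0 <= x -> x <= y -> g x <= g y) ->
  forall x, 0 <= x -> g x = x * g 1.
Proof.
move=> gD gle x x0.
have g0 : g 0 = 0 by apply: (addIr (g 0)); rewrite -gD// !add0r.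
have gMn n y : 0 <= y -> g (y *+ n) = g y *+ n.
  move=> y0; elim: n => [|n IHn]; first by rewrite !mulr0n.
  by rewrite !mulrS gD ?mulrn_wge0// IHn.
have g1 : 0 <= g 1 by rewrite -g0 gle.
(* With [m] the integer part of [x *+ n], both [g (x *+ n)] and [x *+ n * g 1] lie between [m * g 1]
   and [(m + 1) * g 1]. The bound does not depend on [n], so the Archimedean property forces the
   difference to vanish. *)
have bound n : `|g x - x * g 1| *+ n <= g 1.
  rewrite -normrMn mulrnBl -mulrnAl -gMn//.
  have xn0 : 0 <= x *+ n by rewrite mulrn_wge0.
  have /andP[] := truncn_itv xn0; set m := Num.trunc _ => mx xm.
  have gm i : g i%:R = i%:R * g 1 by rewrite gMn// mulr_natl.
  have h1 := gle _ _ (ler0n R m) mx.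
  have h2 := gle _ _ xn0 (ltW xm).
  have h3 := ler_wpM2r g1 mx.
  have h4 := ler_wpM2r g1 (ltW xm).
  rewrite !gm -natr1 mulrDl mul1r in h1 h2 h3 h4.
  by rewrite ler_norml; apply/andP; split; lra.
apply/eqP; rewrite -subr_eq0 -normr_eq0; apply/negPn/negP => d0.
have {}d0 : 0 < `|g x - x * g 1| by rewrite lt_def d0 normr_ge0.
have := bound (Num.trunc (g 1 / `|g x - x * g 1|)).+1.
apply/negP; rewrite -ltNge -mulr_natl -ltr_pdivrMr//.
exact: truncnS_gt.
Qed.

Lemma exponential_of_translation_equation (R : realType) (U : R -> R) :
    strictly_increasing_on `[0, +oo[ U -> strictly_convex_on `[0, +oo[ U ->
    (forall z y c, 0 < z -> z < y -> 0 <= c ->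
      (U (z + c) - U c) * (U y - U 0) = (U (y + c) - U c) * (U z - U 0)) ->
  exists rho a b : R, [/\ 0 < rho, 0 < b &
    forall l, 0 <= l -> U l = a + b * (rho * (expR (l / rho) - 1))].
Proof.
move=> Uincr Uconv Utr.
have A0 (x : R) : 0 <= x -> `[0, +oo[%classic x by rewrite /= in_itv/= andbT.
pose u x := U x - U 0.
have u_lt x y : 0 <= x -> x < y -> u x < u y.
  by move=> x0 xy; rewrite ltrD2r Uincr//; apply: A0; rewrite // (le_trans x0)// ltW.
have u0 : u 0 = 0 by rewrite /u subrr.
have u_le x y : 0 <= x -> x <= y -> u x <= u y.
  by move=> x0; rewrite le_eqVlt => /predU1P[->//|xy]; exact/ltW/u_lt.
have u_gt0 x : 0 < x -> 0 < u x by move=> x0; rewrite -u0 u_lt.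
have u1 := u_gt0 1 ltr01.
(* The hypothesis says that [(u (z + c) - u c) / u z] does not depend on [z]; [al c] is its value at
   the reference point 1. *)
pose al c := (u (1 + c) - u c) / u 1.
have uE z c : 0 <= z -> 0 <= c -> u (z + c) = u c + al c * u z.
  rewrite le_eqVlt => /predU1P[<- c0|z0 c0]; first by rewrite add0r u0 mulr0 addr0.
  suff : u (z + c) - u c = al c * u z by move=> h; lra.
  rewrite /al mulrAC.
  apply: (mulIf (lt0r_neq0 u1)); rewrite mulfVK ?lt0r_neq0//.
  have [z1|z1|->//] := ltgtP z 1.
  - by have := Utr _ _ _ z0 z1 c0; rewrite /u => h; lra.
  - by have := Utr _ _ _ ltr01 z1 c0; rewrite /u => h; lra.
pose k := (al 1 - 1) / u 1.
have ku : k * u 1 = al 1 - 1 by rewrite /k mulfVK// lt0r_neq0.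
(* Expanding [u (1 + c)] with either summand as the shift and comparing shows that [al] is affine in
   [u]. *)
have alE c : 0 <= c -> al c = 1 + k * u c.
  move=> c0; have h : u c + al c * u 1 = u 1 + al 1 * u c.
    by rewrite -!uE// addrC.
  apply: (mulIf (lt0r_neq0 u1)).
  have -> : (1 + k * u c) * u 1 = u 1 + (k * u 1) * u c by ring.
  by rewrite ku; lra.
(* Strict convexity at the midpoint 1 of 0 and 2 gives [u 2 > 2 * u 1], while the functional
   equation gives [u 2 = 2 * u 1 + k * u 1 ^ 2]. *)
have k0 : 0 < k.
  have := Uconv 0 2 2^-1 (A0 _ (lexx _)) (A0 _ (ler0n _ _)).
  have -> : 2^-1 * 0 + (1 - 2^-1) * 2 = 1 :> R by field.
  move=> /(_ _ _)-/(_ _)/(_ _) h.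
  have {}h : U 1 < 2^-1 * U 0 + (1 - 2^-1) * U 2.
    by apply: h; [rewrite lt_eqF// ltr0n|apply/andP; split; lra].
  have := uE 1 1 ler01 ler01; rewrite alE// => h2.
  have : 0 < k * (u 1 * u 1).
    by move: h h2; rewrite /u (_ : 1 + 1 = 2 :> R)//; lra.
  by rewrite pmulr_lgt0// mulr_gt0.
(* [f] turns sums into products and is at least 1, so [ln (f x)] is additive and nondecreasing,
   hence linear. *)
pose f x := 1 + k * u x.
have f_ge1 x : 0 <= x -> 1 <= f x.
  by move=> x0; rewrite lerDl mulr_ge0 ?(ltW k0)// -u0 u_le.
have f_gt0 x : 0 <= x -> 0 < f x by move=> x0; rewrite (lt_le_trans ltr01)// f_ge1.
have fD x y : 0 <= x -> 0 <= y -> f (x + y) = f x * f y.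
  by move=> x0 y0; rewrite /f uE// alE//; ring.
have lnfE := @additive_nondecreasing_linear R (fun x => ln (f x)).
have {}lnfE x : 0 <= x -> ln (f x) = x * ln (f 1).
  apply: lnfE => [v w v0 w0|v w v0 vw].
    by rewrite fD// lnM ?posrE ?f_gt0.
  rewrite ler_ln ?posrE ?f_gt0 ?(le_trans v0)//.
  by rewrite lerD2l ler_wpM2l ?(ltW k0)// u_le.
have lnf1 : 0 < ln (f 1) by rewrite ln_gt0// ltrDl mulr_gt0.
(* Since [f l = expR (l * ln (f 1))], the rate [1 / rho] is [ln (f 1)]; [b] is chosen so that
   [b * rho = k^-1]. *)
exists (ln (f 1))^-1, (U 0), (k^-1 * ln (f 1)); split.
- by rewrite invr_gt0.
- by rewrite mulr_gt0// invr_gt0.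
move=> l l0; rewrite invrK -lnfE// lnK ?posrE ?f_gt0// /f addrAC subrr add0r.
rewrite -mulrA mulVKf ?lt0r_neq0// mulKf ?lt0r_neq0//.
by rewrite /u addrC subrK.
Qed.

(** Points to the right of [x] stay in the half-line, so this one-sided form of continuity carries
    no domain condition on [y]. *)
Lemma continuous_within_right (R : realType) (U : R -> R) (x e : R) :
    {within `[0, +oo[, continuous U} -> 0 <= x -> 0 < e ->
  exists2 delta, 0 < delta & forall y, x <= y -> y < x + delta -> U y < U x + e.
Proof.
move=> Ucont x0 e0.
have xA : `[0, +oo[%classic x by rewrite /= in_itv/= andbT.
have /(_ x) Ux := (subspace_continuousP _ _).1 Ucont.
have /cvgrPdist_lt/(_ e e0) := Ux xA.
move=> -[delta /= delta0 Hd]; exists delta => // y xy yd.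
have y0 : 0 <= y by rewrite (le_trans x0).
have yA : `[0, +oo[%classic y by rewrite /= in_itv/= andbT.
have := Hd y; rewrite /ball_/= distrC ger0_norm ?subr_ge0// ltrBlDl => /(_ yd yA).
by rewrite distrC => /(le_lt_trans (ler_norm _)); rewrite ltrBlDl.
Qed.

(* [s1], [s2], [s1 + s2] play the certain equivalents of a loss close to the
   lottery [p 0 + q y], of a loss close to [c], and of their sum. *)
Lemma translation_equation_of_approx (R : realType) (U : R -> R) (p q z y c : R) :
    {within `[0, +oo[, continuous U} -> strictly_increasing_on `[0, +oo[ U ->
    0 <= p -> 0 <= q -> p + q = 1 -> 0 <= z -> 0 < y -> 0 <= c ->
    U z = p * U 0 + q * U y ->
    (forall e, 0 < e -> e < y -> exists s1 s2, [/\ 0 <= s1, 0 <= s2,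
      U z <= U s1 <= p * U e + q * U (y + e),
      U c <= U s2 <= U (c + e) &
      p * U c + q * U (y + c) <= U (s1 + s2) <=
        p * U (c + e *+ 2) + q * U (y + c + e *+ 2)]) ->
  U (z + c) = p * U c + q * U (y + c).
Proof.
move=> Ucont Uincr p0 q0 pq z0 y0 c0 Uz approx.
have A0 (x : R) : 0 <= x -> `[0, +oo[%classic x by rewrite /= in_itv/= andbT.
have U_le s t : 0 <= s -> s <= t -> U s <= U t.
  move=> s0; rewrite le_eqVlt => /predU1P[->//|st].
  by rewrite ltW// Uincr//; apply: A0; rewrite // (le_trans s0)// ltW.
have U_lt_inv s t : 0 <= t -> U s < U t -> s < t.
  by move=> t0; rewrite !ltNge; apply: contra; exact: U_le.
have U_le_inv s t : 0 <= s -> 0 <= t -> U s <= U t -> s <= t.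
  move=> s0 t0; rewrite !leNgt; apply: contra => ts.
  by apply: Uincr => //; exact: A0.
have right := fun x e => @continuous_within_right R U x e Ucont.
have comb s t s' t' : s <= s' -> t <= t' -> p * s + q * t <= p * s' + q * t'.
  by move=> ? ?; rewrite lerD// ler_wpM2l.
have comb_e s t e : p * (s + e) + q * (t + e) = p * s + q * t + e.
  by rewrite !mulrDr addrACA -mulrDl pq mul1r.
apply/eqP; rewrite eq_le; apply/andP; split; apply/ler_addgt0Pr => eta eta0.
(* Upper bound: [z + c <= s1 + s2], and continuity at [c] and [y + c] absorbs the shift [e *+ 2] in
   the bound on [U (s1 + s2)]. *)
- have yc0 : 0 <= y + c by rewrite addr_ge0// ltW.
  have [d1 d10 Hd1] := right c eta c0 eta0.
  have [d2 d20 Hd2] := right (y + c) eta yc0 eta0.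
  (* Dividing by 4 keeps [e *+ 2] strictly below [d1] and [d2], and [e] below [y]. *)
  pose e := Num.min (Num.min d1 d2) y / 4.
  have : 0 < Num.min (Num.min d1 d2) y by rewrite !lt_min d10 d20 y0.
  have : Num.min (Num.min d1 d2) y <= d1 by rewrite !ge_min lexx.
  have : Num.min (Num.min d1 d2) y <= d2 by rewrite !ge_min lexx orbT.
  have : Num.min (Num.min d1 d2) y <= y by rewrite !ge_min lexx !orbT.
  set m := Num.min _ _ in e * => my m2 m1 m0.
  have e0 : 0 < e by rewrite /e; lra.
  have ey : e < y by rewrite /e; lra.
  have [s1 [s2 [s10 s20 /andP[s1z _] /andP[s2c _] /andP[_ s12]]]] := approx e e0 ey.
  have zcs : z + c <= s1 + s2 by rewrite lerD// U_le_inv.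
  rewrite (le_trans (U_le _ _ (addr_ge0 z0 c0) zcs))//.
  rewrite (le_trans s12)// -comb_e; apply: comb; apply/ltW.
  + by apply: Hd1; rewrite /e; lra.
  + by apply: Hd2; rewrite /e; lra.
(* Lower bound: [s1 + s2] exceeds [z + c] by at most [d / 2], and continuity at [z + c] controls [U]
   there. *)
- have zc0 : 0 <= z + c by rewrite addr_ge0.
  have [d d0 Hd] := right (z + c) eta zc0 eta0.
  have zd0 : 0 <= z + d / 4 by lra.
  (* This gap turns an upper bound on [U s1] into [s1 <= z + d / 4] by monotonicity, in place of
     continuity of the inverse. *)
  have kap0 : 0 < U (z + d / 4) - U z.
    by rewrite subr_gt0 Uincr//; [exact: A0|exact: A0|lra].
  have [d1 d10 Hd1] := right 0 _ (lexx _) kap0.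
  have [d2 d20 Hd2] := right y _ (ltW y0) kap0.
  pose e := Num.min (Num.min d1 d2) (Num.min y d) / 4.
  have : 0 < Num.min (Num.min d1 d2) (Num.min y d) by rewrite !lt_min d10 d20 y0 d0.
  have : Num.min (Num.min d1 d2) (Num.min y d) <= d1 by rewrite !ge_min lexx.
  have : Num.min (Num.min d1 d2) (Num.min y d) <= d2 by rewrite !ge_min lexx orbT.
  have : Num.min (Num.min d1 d2) (Num.min y d) <= y by rewrite !ge_min lexx !orbT.
  have : Num.min (Num.min d1 d2) (Num.min y d) <= d by rewrite !ge_min lexx !orbT.
  set m := Num.min (Num.min _ _) _ in e * => md my m2 m1 m0.
  have e0 : 0 < e by rewrite /e; lra.
  have ey : e < y by rewrite /e; lra.
  have [s1 [s2 [s10 s20 /andP[_ s1z] /andP[_ s2c] /andP[s12 _]]]] := approx e e0 ey.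
  have s1d : s1 <= z + d / 4.
    apply: U_le_inv => //; apply: (le_trans s1z).
    have -> : U (z + d / 4) = p * (U 0 + (U (z + d / 4) - U z)) +
        q * (U y + (U (z + d / 4) - U z)).
      by rewrite comb_e -Uz; lra.
    apply: comb; apply/ltW.
    + by apply: Hd1; rewrite /e; lra.
    + by apply: Hd2; rewrite /e; lra.
  have s2d : s2 <= c + e by apply: U_le_inv => //; rewrite addr_ge0// ltW.
  have s12d : s1 + s2 <= z + c + d / 2 by move: s1d s2d; rewrite /e; lra.
  rewrite (le_trans s12)// (le_trans (U_le _ _ _ s12d)) ?addr_ge0//.
  by apply/ltW/Hd; lra.
Qed.

(** * Approximate lotteries *)

(** Split the integral over [A] and its complement and compare with constants on each piece. *)
Lemma expectation_two_step_bounds d (T : measurableType d) (R : realType)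
    (P : probability T R) (A : set T) (g : T -> R)
    (p q a1 a2 b1 b2 : R) :
    measurable A -> measurable_fun setT g -> (forall w, 0 <= g w) ->
    P A = p%:E -> p + q = 1 -> 0 <= a1 -> 0 <= a2 -> 0 <= b1 -> 0 <= b2 ->
    {ae P, forall w, (A w -> a1 <= g w <= b1) /\ (~ A w -> a2 <= g w <= b2)} ->
  ((p * a1 + q * a2)%:E <= \int[P]_w (g w)%:E <= (p * b1 + q * b2)%:E)%E.
Proof.
move=> mA mg g0 PA pq a10 a20 b10 b20 Hg.
have PAC : P (~` A) = q%:E.
  by rewrite probability_setC// PA -EFinB; congr EFin; rewrite -pq addrAC subrr add0r.
have mgE D : measurable_fun D (fun w => (g w)%:E).
  by apply/measurable_EFinP; exact: measurable_funTS.
have -> : (\int[P]_w (g w)%:E =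
    \int[P]_(w in A) (g w)%:E + \int[P]_(w in ~` A) (g w)%:E)%E.
  rewrite -ge0_integral_setU//; last 3 first.
  - exact: measurableC.
  - by move=> w _; rewrite lee_fin.
  - by apply/disj_set2P; rewrite setICr.
  by rewrite setUv.
have cstE (c r : R) (B : set T) : measurable B -> P B = r%:E ->
    (r * c)%:E = (\int[P]_(w in B) (cst c%:E) w)%E.
  by move=> mB PB; rewrite integral_cst// EFinM muleC -PB.
have mAC : measurable (~` A) by exact: measurableC.
rewrite !EFinD !(cstE _ _ _ mA PA) !(cstE _ _ _ mAC PAC).
apply/andP; split; apply: leeD; apply: ae_ge0_le_integral => //;
  [by move=> w _; rewrite lee_fin
  |apply: filterS Hg => w [HA HAC] Aw; rewrite lee_fin
  |by move=> w _; rewrite lee_fin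
  |apply: filterS Hg => w [HA HAC] Aw; rewrite lee_fin
  |by move=> w _; rewrite lee_fin
  |apply: filterS Hg => w [HA HAC] Aw; rewrite lee_fin
  |by move=> w _; rewrite lee_fin
  |apply: filterS Hg => w [HA HAC] Aw; rewrite lee_fin].
- by have /andP[] := HA Aw.
- by have /andP[] := HAC Aw.
- by have /andP[] := HA Aw.
- by have /andP[] := HAC Aw.
Qed.

Section certain_equivalent_bounds.
Context (R : realType) (U : R -> R).
Hypothesis Ucont : {within `[0, +oo[, continuous U}.
Hypothesis Uincr : strictly_increasing_on `[0, +oo[ U.

Let U_le s t : 0 <= s -> s <= t -> U s <= U t.
Proof.
move=> s0; rewrite le_eqVlt => /predU1P[->//|st].
by rewrite ltW// Uincr//= in_itv/= andbT// (le_trans s0)// ltW.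
Qed.

(** Extending [U] by the constant [U 0] to the left and subtracting [U 0] gives a nonnegative
    function that is monotone, hence measurable, on the whole line. *)
Let u (x : R) := U (Num.max 0 x) - U 0.

Let u_le : {homo u : x y / x <= y}.
Proof.
move=> x y xy; rewrite lerD2r; apply: U_le; first by rewrite le_max lexx.
by rewrite ge_max !le_max lexx xy orbT.
Qed.

Let u_ge0 x : 0 <= u x.
Proof. by rewrite subr_ge0 U_le// le_max lexx. Qed.

Let UuE l : 0 <= l -> U l = U 0 + u l.
Proof. by move=> l0; rewrite /u max_r// addrC subrK. Qed.

Context d (T : measurableType d) (P : probability T R).

Lemma CE_two_step_bounds (X : {RV P >-> R}) (D : R -> R) (A : set T)
    (p q a1 a2 b1 b2 : R) :
    has_density X D -> measurable A -> P A = p%:E ->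
    0 <= p -> 0 <= q -> p + q = 1 ->
    0 <= a1 -> 0 <= a2 -> a1 <= b1 -> a2 <= b2 ->
    {ae P, forall w, (A w -> a1 <= X w <= b1) /\ (~ A w -> a2 <= X w <= b2)} ->
  finite_expected_disutility U D /\
  exists2 s, 0 <= s & CE U D = s /\
    p * U a1 + q * U a2 <= U s <= p * U b1 + q * U b2.
Proof.
move=> XD mA PA p0 q0 pq a10 a20 ab1 ab2 HX.
have b10 : 0 <= b1 by exact: le_trans ab1.
have b20 : 0 <= b2 by exact: le_trans ab2.
have mu : measurable_fun setT u by exact: nondecreasing_measurable.
have muX : measurable_fun setT (fun w => u (X w)) by exact: measurableT_comp.
have := @expectation_two_step_bounds _ _ _ P A (fun w => u (X w)) p q
  (u a1) (u a2) (u b1) (u b2) mA muX (fun w => u_ge0 _) PA pq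
  (u_ge0 _) (u_ge0 _) (u_ge0 _) (u_ge0 _).
case/(_ _)/andP.
  apply: filterS HX => w [HA HAC].
  by split=> [/HA|/HAC] /andP[? ?]; apply/andP; split; exact: u_le.
move=> loE Ehi.
have E_lty : (\int[P]_w (u (X w))%:E < +oo)%E by exact: le_lt_trans Ehi (ltry _).
have finD := (finite_expected_disutility_shift XD mu u_ge0 UuE).2 E_lty.
have vE := expected_disutility_shift XD mu u_ge0 UuE finD.
split=> //; set v := expected_disutility U D in vE *.
have mixE s t : 0 <= s -> 0 <= t ->
    p * U s + q * U t = U 0 + (p * u s + q * u t).
  by move=> s0 t0; rewrite (UuE s0) (UuE t0) !mulrDr addrACA -mulrDl pq mul1r.
have /andP[lov vhi] : p * U a1 + q * U a2 <= v <= p * U b1 + q * U b2.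
  rewrite !mixE//; apply/andP; split; rewrite -lee_fin vE EFinD; exact: leeD2l.
(* The mixtures lie between [U 0] and [U (Num.max b1 b2)], so the intermediate value theorem yields
   a preimage of [v]. *)
have mix_max : p * U b1 + q * U b2 <= U (Num.max b1 b2).
  rewrite -[leRHS]mul1r -pq mulrDl; apply: lerD; apply: ler_wpM2l => //;
  by apply: U_le => //; rewrite le_max lexx ?orbT.
have mix_0 : U 0 <= p * U a1 + q * U a2.
  by rewrite -[leLHS]mul1r -pq mulrDl; apply: lerD; apply: ler_wpM2l => //; exact: U_le.
have bmax0 : 0 <= Num.max b1 b2 by rewrite le_max b10.
have Ucont' : {within `[0, Num.max b1 b2], continuous U}.
  apply: continuous_subspaceW Ucont => x /=.
  by rewrite !in_itv/= => /andP[->].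
have [|s] := @IVT _ _ _ _ v bmax0 Ucont'.
  rewrite ge_min le_max (le_trans mix_0 lov)/=.
  by rewrite (le_trans vhi mix_max) orbT.
rewrite in_itv/= => /andP[s0 _] Us; exists s => //; split; first exact: CE_eq.
by rewrite Us lov.
Qed.

End certain_equivalent_bounds.

(** * Uniform laws and the density of an independent sum *)

Section uniform_law.
Context (R : realType).
Local Notation RR := (measurableTypeR R).
Local Notation lambda := (@lebesgue_measure R).

(** The translated measure gives half-open intervals their length, and this determines Lebesgue
    measure. *)
Lemma lebesgue_measure_translate (x : R) (A : set RR) :
  measurable A -> lambda [set y | A (x + y)] = lambda A.
Proof.
move=> mA.
have mshift : @measurable_fun _ _ RR RR setT (fun y : R => x + y).
  have h : measurable_fun setT (fun y : R => x + y) by exact: measurable_funD.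
  exact: h.
pose shift : {mfun RR >-> RR} := @mfun_Sub _ _ RR RR _ (mem_set mshift).
pose nu : {measure set RR -> \bar R} := pushforward lambda shift.
rewrite -[LHS]/(nu mshift A); apply/esym; apply: lebesgue_measure_unique => //.
move=> _ [[a b] _ <-] /=; rewrite /nu/= /pushforward.
have -> : shift @^-1` `]a, b] = `]a - x, b - x]%classic.
  by apply/seteqP; split => y; rewrite /= !in_itv/= ltrBlDl lerBrDl.
rewrite !lebesgue_measure_itv/= !lte_fin ltrD2r; case: ifPn => // _.
by rewrite -!EFinB; congr EFin; ring.
Qed.

Lemma uniform_law (S : set RR) (e : R) : measurable S -> 0 < e ->
    lambda S = e%:E ->
  exists mu : probability RR R,
    forall B, measurable B -> mu B = (e^-1%:E * lambda (B `&` S))%E.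
Proof.
move=> mS e0 lS.
(* The Dirac mass is the default of [mnormalize] for total mass 0 or infinity; here the mass is [e],
   finite and positive. *)
exists (mnormalize (mrestr lambda mS) (dirac (0 : RR))) => B mB.
rewrite /= /mnormalize/= /mrestr setTI lS eqe gt_eqF//=.
by rewrite muleC.
Qed.

End uniform_law.

Section product_of_laws.
Context (R : realType).
Local Notation RR := (measurableTypeR R).
Local Notation lambda := (@lebesgue_measure R).
Variables (mu1 mu2 : probability RR R).

Let P : probability (RR * RR)%type R := (mu1 \x mu2)%E.

Let measurable_fst_R : @measurable_fun _ _ (RR * RR)%type R setT fst.
Proof. exact: (@measurable_fst _ _ RR RR). Qed.

Let measurable_snd_R : @measurable_fun _ _ (RR * RR)%type R setT snd.
Proof. exact: (@measurable_snd _ _ RR RR). Qed.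

Let X1 : {RV P >-> R} := @mfun_Sub _ _ (RR * RR)%type R fst (mem_set measurable_fst_R).
Let X2 : {RV P >-> R} := @mfun_Sub _ _ (RR * RR)%type R snd (mem_set measurable_snd_R).

Let distribution_fst (B : set R) : measurable B -> P (X1 @^-1` B) = mu1 B.
Proof.
move=> mB; have -> : X1 @^-1` B = B `*` setT.
  by apply/seteqP; split => [[x y]//|[x y] []].
by rewrite [LHS]product_measure1E// [X in (_ * X)%E]probability_setT mule1.
Qed.

Let distribution_snd (B : set R) : measurable B -> P (X2 @^-1` B) = mu2 B.
Proof.
move=> mB; have -> : X2 @^-1` B = setT `*` B.
  by apply/seteqP; split => [[x y]//|[x y] []].
by rewrite [LHS]product_measure1E// [X in (X * _)%E]probability_setT mul1e.
Qed.

Let independent_fst_snd : independent_RVs X1 X2.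
Proof.
move=> A B mA mB; rewrite distribution_fst// distribution_snd//.
have -> : X1 @^-1` A `&` X2 @^-1` B = A `*` B by [].
exact: product_measure1E.
Qed.

Variables (S : set RR) (c e : R).
Hypotheses (mS : measurable S) (S0 : forall x, S x -> 0 <= x).
Hypotheses (c0 : 0 <= c) (e0 : 0 < e).
Hypothesis mu1E : forall B, measurable B ->
  mu1 B = (e^-1%:E * lambda (B `&` S))%E.
Hypothesis mu2E : forall B, measurable B ->
  mu2 B = (e^-1%:E * lambda (B `&` `[c, (c + e)%R]))%E.

Let ei0 : 0 <= e^-1. Proof. by rewrite invr_ge0 ltW. Qed.

Let uniform_density (nu : probability RR R) (V : set RR) :
    measurable V -> (forall x, V x -> 0 <= x) ->
    (forall B, measurable B -> nu B = (e^-1%:E * lambda (B `&` V))%E) ->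
  forall B : set RR, measurable B ->
  nu B = (\int[lambda]_(l in B `&` `[0%R, +oo[) (e^-1 * \1_V l)%:E)%E.
Proof.
move=> mV V0 nuE B mB; rewrite nuE//.
have mB0 : measurable (B `&` `[0%R, +oo[%classic : set RR).
  by apply: measurableI => //; exact: measurable_itv.
under [RHS]eq_integral do rewrite EFinM.
rewrite ge0_integralZl//; last first.
  by apply/measurable_EFinP; exact: measurable_indic.
rewrite integral_indic//; congr (_ * lambda _)%E.
apply/seteqP; split => x /=.
  by move=> [Bx Vx]; split => //; split => //; rewrite in_itv/= V0.
by move=> [Vx [Bx _]].
Qed.

Let has_density_fst : has_density X1 (fun l => e^-1 * \1_S l).
Proof.
split.
- have h : measurable_fun (setT : set RR) (fun l : R => e^-1 * \1_S l).
    by apply: measurable_funM => //; exact: measurable_indic.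
  exact: (measurable_funTS h).
- by move=> l _; rewrite mulr_ge0.
- move=> B mB; rewrite [LHS]distribution_fst//.
  exact: (uniform_density mS S0 mu1E).
Qed.

Let has_density_snd : has_density X2 (fun l => e^-1 * \1_(`[c, (c + e)%R] : set RR) l).
Proof.
have mI : measurable (`[c, (c + e)%R]%classic : set RR) by exact: measurable_itv.
split.
- have h : measurable_fun (setT : set RR) (fun l : R => e^-1 * \1_(`[c, (c + e)%R] : set RR) l).
    by apply: measurable_funM => //; exact: measurable_indic.
  exact: (measurable_funTS h).
- by move=> l _; rewrite mulr_ge0.
- move=> B mB; rewrite [LHS]distribution_snd//.
  apply: (uniform_density mI _ mu2E) => // x /=.
  by rewrite in_itv/= => /andP[cx _]; rewrite (le_trans c0).
Qed.

(* The convolution of [mu1] with the uniform density on [[c, c + e]]. *)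
Let dens (z : R) : R := e^-1 * fine (mu1 `[z - (c + e), z - c]%classic).

Let has_density_add : has_density (X1 \+ X2 : {RV P >-> R}) dens.
Proof.
(* In coordinates [(x, z)] with [z = x + y], the window for [y] becomes an oblique band; its section
   at height [z] is the interval in [dens]. *)
pose band : set (RR * RR) := [set w | c <= w.2 - w.1 <= c + e].
have mdiff : @measurable_fun _ _ (RR * RR)%type RR setT (fun w => w.2 - w.1 : R).
  have h : @measurable_fun _ _ (RR * RR)%type R setT (fun w => w.2 - w.1 : R).
    exact: measurable_funB.
  exact: h.
have mband : measurable band.
  rewrite (_ : band = setT `&` (fun w => w.2 - w.1 : R) @^-1` `[c, (c + e)%R]).
    by apply: mdiff => //; exact: measurable_itv.
  by apply/seteqP; split => w /=; rewrite in_itv/=; [split|case].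
have ysecE z : ysection band z = `[z - (c + e), z - c]%classic.
  apply/seteqP; split => x; rewrite /ysection/= inE /band/= in_itv/=; lra.
have mdens : @measurable_fun _ _ RR R setT dens.
  apply: measurable_funM => //; apply: measurableT_comp => //.
  have := measurable_fun_ysection mu1 mband.
  by apply: eq_measurable_fun => z _ /=; rewrite ysecE.
have densE z : (dens z)%:E = (e^-1%:E * mu1 (ysection band z))%E.
  by rewrite EFinM fineK ?ysecE// fin_num_measure//; exact: measurable_itv.
split.
- exact: (measurable_funTS mdens).
- by move=> l _; rewrite mulr_ge0// fine_ge0.
move=> B mB.
pose A : set (RR * RR) := band `&` [set w | B w.2].
have mA : measurable A.
  apply: measurableI => //.
  by rewrite -[X in measurable X]setTI; exact: (@measurable_snd _ _ RR RR).
(* For fixed [x], translation by [x] carries Lebesgue measure in [y] to Lebesgue measure in the sum,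
   where the event becomes a section of [A]. *)
transitivity (\int[mu1]_x (e^-1%:E * lambda (xsection A x)))%E.
  apply: eq_integral => x _ /=.
  have -> : xsection ((X1 \+ X2) @^-1` B) x = [set y | B (x + y)].
    by apply/seteqP; split => y; rewrite /xsection/= inE.
  rewrite mu2E; last first.
    have h : measurable_fun setT (fun y : R => x + y) by exact: measurable_funD.
    by rewrite -[X in measurable X]setTI; exact: h.
  rewrite -(lebesgue_measure_translate x (measurable_xsection x mA)).
  congr (_ * lambda _)%E; apply/seteqP; split => y;
    by rewrite /xsection/= inE /A/band/= in_itv/= [x + y]addrC addrK => -[].
rewrite ge0_integralZl//; last exact: measurable_fun_xsection.
(* Exchanging the order of integration makes the value [z] of the sum the outer variable. *)
transitivity (e^-1%:E * (mu1 \x^ lambda) A)%E.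
  congr (_ * _)%E; apply: product_measure_unique => //= ? ? ? ?.
  by rewrite product_measure2E.
rewrite /product_measure2 -ge0_integralZl//; last exact: measurable_fun_ysection.
rewrite [RHS]integral_mkcond; apply: eq_integral => z _ /=.
rewrite patchE; case: ifPn => [|zB].
  rewrite inE/= => -[Bz _]; rewrite densE; congr (_ * mu1 _)%E.
  by apply/seteqP; split => x; rewrite /ysection/= !inE /A/=; [case|].
(* Either [z] is outside [B] and the section is empty, or [z < 0]; then the band forces
   [x <= z < 0], which misses [S]. *)
rewrite [X in (_ * X)%E](_ : _ = 0%E) ?mule0//.
have [Bz|nBz] := pselect (B z); last first.
  rewrite (_ : ysection A z = set0) ?measure0//.
  by rewrite -subset0 => x; rewrite /ysection/= inE => -[].
have z0 : z < 0.
  by rewrite ltNge; apply: contra zB => z0; rewrite inE/= in_itv/= z0.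
rewrite mu1E; last exact: measurable_ysection.
rewrite (_ : _ `&` S = set0) ?measure0 ?mule0//.
rewrite -subset0 => x; rewrite /ysection/= inE /A/band/= => -[[/andP[h _] _] Sx].
have x0 := S0 Sx; have : (z : R) - (x : R) < 0 by rewrite subr_lt0 (lt_le_trans z0).
by move=> /(le_lt_trans h); rewrite ltNge c0.
Qed.

Lemma uniform_losses_exist : exists (d : measure_display) (T : measurableType d)
    (Q : probability T R) (Y1 Y2 : {RV Q >-> R}) (D1 D2 D : R -> R),
  [/\ {ae Q, forall w, S (Y1 w) /\ c <= Y2 w <= c + e},
      forall B : set R, measurable B -> Q (Y1 @^-1` B) = mu1 B,
      independent_RVs Y1 Y2,
      has_density Y1 D1 /\ has_density Y2 D2 &
      has_density (Y1 \+ Y2 : {RV Q >-> R}) D].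
Proof.
exists _, (RR * RR)%type, P, X1, X2, (fun l => e^-1 * \1_S l),
  (fun l => e^-1 * \1_(`[c, (c + e)%R] : set RR) l), dens; split => //.
have mI : measurable (`[c, (c + e)%R]%classic : set RR) by exact: measurable_itv.
have ae1 : {ae P, forall w, S (X1 w)}.
  exists (X1 @^-1` (~` S)); split => //.
  - rewrite -[X in measurable X]setTI; apply: measurable_fst_R => //.
    exact: measurableC.
  - rewrite distribution_fst; last exact: measurableC.
    by rewrite mu1E ?setICl ?measure0 ?mule0//; exact: measurableC.
have ae2 : {ae P, forall w, c <= X2 w <= c + e}.
  exists (X2 @^-1` (~` `[c, (c + e)%R])); split => //.
  - rewrite -[X in measurable X]setTI; apply: measurable_snd_R => //.
    exact: measurableC.
  - rewrite distribution_snd; last exact: measurableC.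
    by rewrite mu2E ?setICl ?measure0 ?mule0//; exact: measurableC.
by apply: filterS2 ae1 ae2 => w.
Qed.

End product_of_laws.

(** The first loss is uniform on the union of [[0, p * e]] and [[y, y + q * e]]. The blocks are
    disjoint as [e < y] and have total length [e], so they receive masses [p] and [q]. *)
Lemma two_block_losses_exist (R : realType) (p q y c e : R) :
    0 <= p -> 0 <= q -> p + q = 1 -> 0 <= c -> 0 < e -> e < y ->
  exists (d : measure_display) (T : measurableType d)
    (P : probability T R) (X1 X2 : {RV P >-> R}) (D1 D2 D : R -> R),
  [/\ {ae P, forall w, (X1 w < y -> 0 <= X1 w <= e) /\
        (~ (X1 w < y) -> y <= X1 w <= y + e) /\ c <= X2 w <= c + e},
      P (X1 @^-1` `]-oo, y[) = p%:E,
      independent_RVs X1 X2,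
      has_density X1 D1 /\ has_density X2 D2 &
      has_density (X1 \+ X2 : {RV P >-> R}) D].
Proof.
move=> p0 q0 pq c0 e0 ey.
have pe : p * e <= e by rewrite ler_piMl ?(ltW e0)// -pq lerDl.
have qe : q * e <= e by rewrite ler_piMl ?(ltW e0)// -pq lerDr.
have pe0 : 0 <= p * e by rewrite mulr_ge0// ltW.
have qe0 : 0 <= q * e by rewrite mulr_ge0// ltW.
pose I1 : set (measurableTypeR R) := `[0, p * e]%classic.
pose I2 : set (measurableTypeR R) := `[y, y + q * e]%classic.
have mI1 : measurable I1 by exact: measurable_itv.
have mI2 : measurable I2 by exact: measurable_itv.
have lambda_itv (s t : R) : 0 <= t -> lebesgue_measure `[s, (s + t)%R] = t%:E.
  rewrite le_eqVlt => /predU1P[<-|t0].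
    by rewrite addr0 lebesgue_measure_itv/= ltxx.
  by rewrite lebesgue_measure_itv/= lte_fin ltrDl t0 -EFinB addrC addKr.
have lI1 : lebesgue_measure I1 = (p * e)%:E 
  by have := lambda_itv 0 (p * e) pe0; rewrite add0r.
have lI2 : lebesgue_measure I2 = (q * e)%:E by rewrite lambda_itv.
have I12 : I1 `&` I2 = set0.
  by rewrite -subset0 => x []; rewrite /I1/I2/= !in_itv/=; lra.
have mS : measurable (I1 `|` I2) by exact: measurableU.
have lS : lebesgue_measure (I1 `|` I2) = e%:E.
  by rewrite measureU// [X in (X + _)%E]lI1 [X in (_ + X)%E]lI2 -EFinD -mulrDl pq mul1r.
have [mu1 mu1E] := uniform_law mS e0 lS.
have mC : measurable (`[c, c + e]%classic : set (measurableTypeR R)).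
  exact: measurable_itv.
have [mu2 mu2E] := uniform_law mC e0 (lambda_itv c e (ltW e0)).
have S0 x : (I1 `|` I2) x -> 0 <= x.
  by case; rewrite /I1/I2/= in_itv/=; lra.
have [d [T [P [X1 [X2 [D1 [D2 [D [HX X1mu ind D12 XD]]]]]]]]] :=
  uniform_losses_exist mS S0 c0 e0 mu1E mu2E.
exists d, T, P, X1, X2, D1, D2, D; split => //.
- apply: filterS HX => w [+ X2w].
  by case; rewrite /I1/I2/= in_itv/= => X1w; split => //; [lra|lra|lra|lra].
- have mB : measurable (`]-oo, y[%classic : set R) by exact: measurable_itv.
  rewrite X1mu// mu1E// (_ : _ `&` _ = I1).
    by rewrite lI1 -EFinM mulrC mulfK// gt_eqF.
  by apply/seteqP; split => x; rewrite /I1/I2/= !in_itv/=; lra.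
Qed.

(** * Equivalence of additivity and the exponential form *)

Theorem mainTheorem1 (R : realType) (U : R -> R)
    (Ucont : {within `[0, +oo[, continuous U})
    (Uincr : strictly_increasing_on `[0, +oo[ U)
    (Uconv : strictly_convex_on `[0, +oo[ U) :
  (forall (d : measure_display) (Omega : measurableType d)
      (P : probability Omega R) (X1 X2 : {RV P >-> R}) (D1 D2 D : R -> R),
    {ae P, forall w, 0 <= X1 w} -> {ae P, forall w, 0 <= X2 w} ->
    independent_RVs X1 X2 ->
    has_density X1 D1 -> has_density X2 D2 ->
    has_density (X1 \+ X2 : {RV P >-> R}) D ->
    finite_expected_disutility U D1 ->
    finite_expected_disutility U D2 ->
    finite_expected_disutility U D ->
    CE U D = CE U D1 + CE U D2)
  <->
  (exists rho a b : R, [/\ 0 < rho, 0 < b &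
    forall l, 0 <= l -> U l = a + b * (rho * (expR (l / rho) - 1))]).
Proof.
split=> [CEadd|[rho [a [b [rho0 b0 UE]]]]]; last first.
  by move=> d T P X1 X2 D1 D2 D; exact: (CE_exponential_add rho0 b0 Uincr UE).
apply: exponential_of_translation_equation => // z y c z0 zy c0.
have y0 : 0 < y by exact: lt_trans zy.
have A0 (x : R) : 0 <= x -> `[0, +oo[%classic x by rewrite /= in_itv/= andbT.
have Uz0 : 0 < U z - U 0 by rewrite subr_gt0 Uincr//; apply: A0 => //; exact: ltW.
have Uyz : 0 < U y - U z by rewrite subr_gt0 Uincr//; apply: A0; exact: ltW.
have Uy0 : 0 < U y - U 0 by lra.
(* These weights make [z] the certain equivalent of the lottery paying [0] with probability [p] and
   [y] with probability [q]. *)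
pose p := (U y - U z) / (U y - U 0); pose q := (U z - U 0) / (U y - U 0).
have p0 : 0 <= p by rewrite divr_ge0// ltW.
have q0 : 0 <= q by rewrite divr_ge0// ltW.
have pq : p + q = 1.
  by rewrite /p /q -mulrDl subrKA divff// gt_eqF.
have qE : q * (U y - U 0) = U z - U 0 by rewrite /q mulfVK// gt_eqF.
have Uz : U z = p * U 0 + q * U y.
  by have -> : p = 1 - q by [lra]; lra.
suff -> : U (z + c) = p * U c + q * U (y + c).
  rewrite -qE; have -> : p = 1 - q by lra.
  by ring.
apply: translation_equation_of_approx => // [|e e0 ey]; first exact: ltW.
have [d [T [P [X1 [X2 [D1 [D2 [D [HX PA ind [XD1 XD2] XD]]]]]]]]] :=
  two_block_losses_exist p0 q0 pq c0 e0 ey.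
have mA : measurable (X1 @^-1` `]-oo, y[).
  by rewrite -[X in measurable X]setTI; apply: measurable_funPT.
have bounds := CE_two_step_bounds Ucont Uincr.
have [fin1 [s1 s10 [CE1 U1]]] : finite_expected_disutility U D1 /\
    exists2 s, 0 <= s & CE U D1 = s /\
      p * U 0 + q * U y <= U s <= p * U e + q * U (y + e).
  apply: (bounds _ _ _ _ _ _ _ _ _ _ _ _ XD1 mA PA) => //; rewrite ?lerDl ?ltW//.
  by apply: filterS HX => w [h1 [h2 _]]; rewrite /= in_itv/=.
(* The same event serves with equal bounds on both sides; [mix] later collapses the two terms into
   one. *)
have [fin2 [s2 s20 [CE2 U2]]] : finite_expected_disutility U D2 /\
    exists2 s, 0 <= s & CE U D2 = s /\
      p * U c + q * U c <= U s <= p * U (c + e) + q * U (c + e).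
  apply: (bounds _ _ _ _ _ _ _ _ _ _ _ _ XD2 mA PA) => //; rewrite ?lerDl ?ltW//.
  by apply: filterS HX => w [_ [_ h]]; split.
have [fin [s s0 [CE12 U12]]] : finite_expected_disutility U D /\
    exists2 s, 0 <= s & CE U D = s /\
      p * U c + q * U (y + c) <= U s <=
      p * U (c + e *+ 2) + q * U (y + c + e *+ 2).
  apply: (bounds _ _ _ _ _ _ _ _ _ _ _ _ XD mA PA) => //.
  - by rewrite addr_ge0// ltW.
  - by rewrite lerDl mulrn_wge0// ltW.
  - by rewrite lerDl mulrn_wge0// ltW.
  - apply: filterS HX => w [h1 [h2 h3]]; rewrite /= in_itv/=.
    by split => [/h1|/h2]; rewrite mulr2n; lra.
have mix t : p * t + q * t = t by rewrite -[RHS]mul1r -pq mulrDl.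
exists s1, s2; split => //; first by rewrite Uz.
  by move: U2; rewrite !mix.
(* Additivity enters here: it identifies [s1 + s2] with the certain equivalent [s] of the sum, to
   which the bounds [U12] apply. *)
rewrite -CE1 -CE2 -(CEadd _ _ _ X1 X2 D1 D2 D)// ?CE12//.
- apply: filterS HX => w [h1 [h2 _]].
  by case: (ltP (X1 w) y) => [/h1/andP[]//|]; rewrite leNgt => /negP/h2; lra.
- by apply: filterS HX => w [_ [_ h]]; lra.
Qed.
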